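(* Let $a,b,c,d\in\mathbb{C}$ with $ad-bc=1$, $c\neq 0$ and $a+d=\pm2$, and let $g(z)=\frac{az+b}{cz+d}$ on $\hat{\mathbb{C}}=\mathbb{C}\cup\{\infty\}$, with fixed point $\alpha=\frac{a-d}{2c}$. Then every horocycle at $\alpha$ of $g$ is invariant under $g$: a point lies in a given horocycle if and only if its image under $g$ lies in the same horocycle. That is, for every $p\in\ell$, a point $z$ satisfies $|z-p|=|p-\alpha|$ if and only if $|g(z)-p|=|\alpha-p|$; and likewise the extended line $L_\infty$ is invariant under $g$.
   Context: $g(\infty)=a/c$, $g(-d/c)=\infty$; the point $\infty$ is not considered to satisfy $|z-p|=|p-\alpha|$. An extended line is a straight line in $\mathbb{C}$ together with $\infty$. $L_\infty$ denotes the extended line containing $\frac ac$, $-\frac dc$ and $\infty$. A horocycle at $\alpha$ is either the extended line $L_\infty$, or a circle that meets $L_\infty$ tangentially at $\alpha$. Let $\ell=\{z\in\mathbb{C}: |z+\frac dc|=|z-\frac ac|\}$, the straight line through $\alpha$ perpendicular to $L_\infty$; the horocycles which are circles are the sets $S_p=\{z:|z-p|=|\alpha-p|\}$ with $p\in\ell$. *)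

(* Defs.v *)
From mathcomp Require Import all_boot all_order all_algebra.
From mathcomp Require Import complex.
From mathcomp Require Import classical_sets reals topology.

Set Implicit Arguments.
Unset Strict Implicit.
Unset Printing Implicit Defensive.

Import GRing.Theory Num.Theory.
Local Open Scope ring_scope.
Local Open Scope complex_scope.
Local Open Scope classical_set_scope.

(* The Riemann sphere; the point at infinity is [None]. *)
Notation sphere R := (one_point_compactification R[i]).

Definition mobius (R : realType) (a b c d : R[i]) (z : sphere R) : sphere R :=
  match z with
  | Some w => if c * w + d == 0 then None else Some ((a * w + b) / (c * w + d))
  | None => if c == 0 then None else Some (a / c)
  end.

Definition extended_line (R : realType) (u v : R[i]) : set (sphere R) :=
  Some @` [set z : R[i] | exists t : R, z = u + t%:C * (v - u)] `|` [set None].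

Definition circle (R : realType) (p : R[i]) (r : R) : set (sphere R) :=
  Some @` [set z : R[i] | `|z - p| = r%:C].

Definition alpha (R : realType) (a c d : R[i]) : R[i] := (a - d) / (2 * c).

Definition L_inf (R : realType) (a c d : R[i]) : set (sphere R) :=
  extended_line (a / c) (- (d / c)).

Definition ell (R : realType) (a c d : R[i]) : set R[i] :=
  [set z | `|z + d / c| = `|z - a / c|].

(* The circle with centre [p] through [q]; it is the single point [q] when
   [p = q]. *)
Definition circle_through (R : realType) (q p : R[i]) : set (sphere R) :=
  Some @` [set z : R[i] | `|z - p| = `|p - q|].

(* A circle and a line are tangent at a point when this is the only point at
   which they meet. *)
Definition horocycle (R : realType) (a c d : R[i]) (H : set (sphere R)) : Prop :=
  H = L_inf a c d \/
  exists (p : R[i]) (r : R),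
    [/\ 0 < r, circle p r `&` L_inf a c d = [set Some (alpha a c d)]
      & H = circle p r].

(* Main.v *)
Require Import Defs.
From mathcomp Require Import all_boot all_order all_algebra.
From mathcomp Require Import complex.
From mathcomp Require Import classical_sets reals topology.
From mathcomp Require Import ring.

(** The substitution [W = k (z - alpha)] with [k = c (a + d) / 2] puts the whole
    configuration in normal form.  Since [(a + d)^2 = 4], it sends [alpha] to
    [0], [a / c] to [1] and [- d / c] to [- 1]; hence [L_inf] becomes the real
    axis and [ell] the imaginary axis, and [g] becomes [W |-> W / (W + 1)],
    the parabolic map fixing [0] (translation by [1] in the coordinate [1 / W]).

    The real axis is visibly invariant under [W / (W + 1)].  A circle through
    [0] with purely imaginary centre [Q] has equation [W W' = Q (W' - W)], where
    a prime denotes conjugation ([norm_sub_imag]), and replacing [W] by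
    [W / (W + 1)] multiplies both sides by [1 / |W + 1|^2], so the equation is
    preserved ([circle_parabolic]).  The points [1], the image of infinity, and [- 1],
    the preimage of infinity, satisfy no such equation.

    It remains to see that a horocycle which is a circle has its centre on
    [ell]: a circle through [0] with centre [Q] meets the real axis also at
    [Q + Q'], so it is tangent there only when [Q] is purely imaginary
    ([tangent_imag]). *)

Import GRing.Theory Num.Theory.
Local Open Scope ring_scope.
Local Open Scope complex_scope.
Local Open Scope classical_set_scope.

(** * Circles through the origin and the map W / (W + 1) *)

Lemma eq_norm_conj (C : numClosedFieldType) (x y : C) :
  `|x| = `|y| <-> x * Num.conj x = y * Num.conj y.
Proof.
rewrite -!normCK; split=> [->//|/eqP].
by rewrite eqrXn2 ?normr_ge0// => /eqP.
Qed.

(** This form of the equation is chosen because [|W|^2] and the imaginary part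
    of [W] both scale by [1 / |W + 1|^2] under [W |-> W / (W + 1)]. *)
Lemma norm_sub_imag (C : numClosedFieldType) (W Q : C) : Num.conj Q = - Q ->
  `|W - Q| = `|Q| <-> W * Num.conj W = Q * (Num.conj W - W).
Proof.
move=> QN; rewrite eq_norm_conj rmorphB/= QN.
split=> h; apply/eqP; rewrite -subr_eq0; apply/eqP.
  by move/eqP: h; rewrite -subr_eq0 => /eqP <-; ring.
by move/eqP: h; rewrite -subr_eq0 => /eqP <-; ring.
Qed.

Lemma real_notin_circle (C : numClosedFieldType) (W Q : C) :
  Num.conj Q = - Q -> W \is Num.real -> W != 0 -> `|W - Q| <> `|Q|.
Proof.
move=> QN /conj_Creal WR W0 /(norm_sub_imag _ _ _ QN)/eqP.
by rewrite WR subrr mulr0 mulf_eq0 orbb (negbTE W0).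
Qed.

Lemma circle_parabolic (C : numClosedFieldType) (W Q : C) :
  Num.conj Q = - Q -> W + 1 != 0 ->
  `|W - Q| = `|Q| <-> `|W / (W + 1) - Q| = `|Q|.
Proof.
move=> QN W1; rewrite !norm_sub_imag// rmorphM/= fmorphV/= rmorphD/= rmorph1.
have W1' : Num.conj W + 1 != 0.
  by move: W1; rewrite -(fmorph_eq0 Num.conj) rmorphD/= rmorph1.
have N0 : (W + 1) * (Num.conj W + 1) != 0 by rewrite mulf_neq0.
have -> : W / (W + 1) * (Num.conj W / (Num.conj W + 1)) =
    W * Num.conj W / ((W + 1) * (Num.conj W + 1)) by field; rewrite W1 W1'.
have -> : Q * (Num.conj W / (Num.conj W + 1) - W / (W + 1)) =
    Q * (Num.conj W - W) / ((W + 1) * (Num.conj W + 1)).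
  by field; rewrite W1 W1'.
by split=> [->//|/(divIf N0)].
Qed.

Lemma real_parabolic (C : numClosedFieldType) (W : C) : W + 1 != 0 ->
  (W \is Num.real) <-> (W / (W + 1) \is Num.real).
Proof.
move=> W1; split=> [WR|VR]; first by rewrite realM ?realV ?realD ?real1.
(* The inverse map is [V |-> V / (1 - V)], where [1 - V = 1 / (W + 1)]. *)
have -> : W = (W / (W + 1)) / (1 - W / (W + 1)).
  by field; rewrite W1 addrAC subrr add0r oner_neq0.
by rewrite realM ?realV ?realB ?real1.
Qed.

Lemma bisector_imag (C : numClosedFieldType) (Q : C) :
  `|Q + 1| = `|Q - 1| -> Num.conj Q = - Q.
Proof.
rewrite eq_norm_conj rmorphD/= rmorphB/= rmorph1 => h.
have h2 : 2 * (Q + Num.conj Q) = 0.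
  by move/eqP: h; rewrite -subr_eq0 => /eqP <-; ring.
move/eqP: h2; rewrite mulf_eq0 pnatr_eq0/= addrC addr_eq0.
by move/eqP.
Qed.

(** The second intersection with the real axis is [Q + Q'], with [Q'] the conjugate
    of [Q], because conjugation preserves the norm. *)
Lemma tangent_imag (C : numClosedFieldType) (Q : C) :
  (forall W, W \is Num.real -> `|W - Q| = `|Q| -> W = 0) -> Num.conj Q = - Q.
Proof.
move=> h; apply/eqP; rewrite -addr_eq0; apply/eqP/h.
  by apply/CrealP; rewrite rmorphD/= conjCK addrC.
by rewrite addrK norm_conjC.
Qed.

(** * The normalising coordinate *)

Definition kappa {R : realType} (a c d : R[i]) : R[i] := c * (a + d) / 2.

Definition coord {R : realType} (a c d z : R[i]) : R[i] :=
  kappa a c d * (z - alpha a c d).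

Section Normalisation.
Variables (R : realType) (a b c d : R[i]).
Hypotheses (det1 : a * d - b * c = 1) (c_neq0 : c != 0).
Hypothesis tr4 : (a + d) ^+ 2 = 4.

Local Notation W := (coord a c d).

Let two_neq0 : 2 != 0 :> R[i]. Proof. by rewrite pnatr_eq0. Qed.

Let tr_neq0 : a + d != 0.
Proof. by rewrite -sqrf_eq0 tr4 pnatr_eq0. Qed.

Lemma kappa_neq0 : kappa a c d != 0.
Proof. by rewrite !mulf_neq0 ?invr_eq0. Qed.

Lemma coord_inj : injective W.
Proof. by move=> x y /(mulfI kappa_neq0)/addIr. Qed.

Lemma coord_alpha : W (alpha a c d) = 0.
Proof. by rewrite /coord subrr mulr0. Qed.

Lemma coordB x y : W x - W y = kappa a c d * (x - y).
Proof. by rewrite /coord; ring. Qed.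

Lemma coord_ac : W (a / c) = 1.
Proof.
have -> : W (a / c) = (a + d) ^+ 2 / 4.
  by rewrite /coord /kappa /alpha; field; rewrite c_neq0.
by rewrite tr4 divff ?pnatr_eq0.
Qed.

Lemma coord_dc : W (- (d / c)) = - 1.
Proof.
have -> : W (- (d / c)) = - ((a + d) ^+ 2 / 4).
  by rewrite /coord /kappa /alpha; field; rewrite c_neq0.
by rewrite tr4 divff ?pnatr_eq0.
Qed.

Lemma coordD1 (z : R[i]) : W z + 1 = (a + d) / 2 * (c * z + d).
Proof.
rewrite -[X in _ + X = _]coord_ac /coord /kappa /alpha.
by field; rewrite c_neq0.
Qed.

Lemma coord_mobius (z : R[i]) : c * z + d != 0 ->
  W ((a * z + b) / (c * z + d)) = W z / (W z + 1).
Proof.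
move=> D0; have bE : b = (a * d - 1) / c.
  by rewrite -det1; field.
have h0 : (a + d) / 2 != 0 by rewrite mulf_neq0 ?invr_eq0.
rewrite coordD1; apply: (mulIf (mulf_neq0 h0 D0)).
rewrite divfK; last exact: mulf_neq0.
rewrite bE /coord /kappa /alpha.
have -> : c * (a + d) / 2 * ((a * z + (a * d - 1) / c) / (c * z + d)
     - (a - d) / (2 * c)) * ((a + d) / 2 * (c * z + d)) =
   (a + d) ^+ 2 / 4 * ((a + d) / 2 * (c * z)
     + (a * d - 1 - d * (a - d) / 2)).
  by field; rewrite c_neq0 D0.
rewrite tr4 divff ?pnatr_eq0// mul1r.
(* The remaining identity becomes formal once the constant is made homogeneous
   by [1 = (a + d)^2 / 4]. *)
have -> : a * d - 1 = a * d - (a + d) ^+ 2 / 4.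
  by rewrite tr4 divff ?pnatr_eq0.
by field; rewrite c_neq0.
Qed.

Lemma circle_through_coord p z :
  circle_through (alpha a c d) p (Some z) <-> `|W z - W p| = `|W p|.
Proof.
have -> : `|W p| = `|kappa a c d| * `|p - alpha a c d| by rewrite -normrM.
rewrite coordB normrM; split=> [[y /= yp [<-]]|h]; first by rewrite yp.
exists z => //=; apply: mulfI h.
by rewrite normr_eq0 kappa_neq0.
Qed.

Lemma L_inf_coord z : L_inf a c d (Some z) <-> W z \is Num.real.
Proof.
have lineE t : W (a / c + t * (- (d / c) - a / c)) = 1 - 2 * t.
  transitivity (W (a / c) + t * (W (- (d / c)) - W (a / c))).
    by rewrite /coord; ring.
  by rewrite coord_ac coord_dc; ring.
split=> [[[y /= [t yt] [<-]]|//]|WR].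
  by rewrite yt lineE realB ?real1// realM ?realn// complex_real.
left; exists z => //=; exists (complex.Re ((1 - W z) / 2)).
rewrite RRe_real; last by rewrite realM ?realB ?real1// realV realn.
apply: coord_inj; rewrite lineE.
by rewrite mulrC divfK// subKr.
Qed.

Lemma circle_through_invariant p : Num.conj (W p) = - W p ->
  forall z : sphere R, circle_through (alpha a c d) p z <->
    circle_through (alpha a c d) p (mobius a b c d z).
Proof.
move=> QN [z|] /=; last first.
  rewrite (negbTE c_neq0) circle_through_coord coord_ac.
  by split=> [[]//|/(real_notin_circle _ _ _ QN (real1 _) (oner_neq0 _))].
have [D0|D0] := eqVneq (c * z + d) 0; rewrite circle_through_coord.
  have Wz : W z = - 1 by apply/eqP; rewrite -addr_eq0 coordD1 D0 mulr0.
  split=> [|[]//]; rewrite Wz => /real_notin_circle.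
  by rewrite realN real1 oppr_eq0 oner_neq0 => /(_ QN isT isT).
rewrite circle_through_coord coord_mobius//; apply: circle_parabolic => //.
by rewrite coordD1 !mulf_neq0 ?invr_eq0.
Qed.

Lemma L_inf_invariant (z : sphere R) :
  L_inf a c d z <-> L_inf a c d (mobius a b c d z).
Proof.
case: z => [z|] /=; last first.
  rewrite (negbTE c_neq0) L_inf_coord coord_ac real1.
  by split=> // _; right.
have [D0|D0] := eqVneq (c * z + d) 0; rewrite L_inf_coord.
  have -> : W z = - 1 by apply/eqP; rewrite -addr_eq0 coordD1 D0 mulr0.
  by rewrite realN real1; split=> // _; right.
rewrite L_inf_coord coord_mobius//; apply: real_parabolic.
by rewrite coordD1 !mulf_neq0 ?invr_eq0.
Qed.

Lemma ell_coord p : ell a c d p -> Num.conj (W p) = - W p.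
Proof.
move=> /= pl; apply: bisector_imag.
rewrite -{2}coord_ac -[1]opprK -coord_dc !coordB !normrM.
by rewrite opprK pl.
Qed.

(** Tangency at [alpha] gives both halves of the description of a circular
    horocycle: incidence fixes the radius, and the absence of another common
    point puts the centre on [ell]. *)
Lemma tangent_coord p r :
  circle p r `&` L_inf a c d = [set Some (alpha a c d)] ->
  Num.conj (W p) = - W p /\ circle p r = circle_through (alpha a c d) p.
Proof.
move=> pr.
have [[y /= + [yE]] _] : (circle p r `&` L_inf a c d) (Some (alpha a c d)).
  by rewrite pr.
rewrite yE => rE.
have crE : circle p r = circle_through (alpha a c d) p.
  by rewrite /circle /circle_through distrC rE.
split=> //; apply: tangent_imag => w wR wp.
have wE : W (alpha a c d + w / kappa a c d) = w.
  by rewrite /coord addrC addKr mulrC divfK ?kappa_neq0.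
have : (circle p r `&` L_inf a c d) (Some (alpha a c d + w / kappa a c d)).
  by rewrite crE; split; [rewrite circle_through_coord|rewrite L_inf_coord];
    rewrite wE.
by rewrite pr /= => -[weq]; rewrite -wE weq coord_alpha.
Qed.

End Normalisation.

Theorem proposition2p5 (R : realType) (a b c d : R[i])
    (det1 : a * d - b * c = 1) (c_neq0 : c != 0)
    (parabolic : a + d = 2 \/ a + d = - 2) :
  (forall H : set (sphere R), horocycle a c d H ->
     forall z : sphere R, H z <-> H (mobius a b c d z)) /\
  (forall p : R[i], ell a c d p ->
     forall z : sphere R,
       circle_through (alpha a c d) p z <->
       circle_through (alpha a c d) p (mobius a b c d z)) /\
  (forall z : sphere R,
     L_inf a c d z <-> L_inf a c d (mobius a b c d z)).
Proof.
have tr4 : (a + d) ^+ 2 = 4 by case: parabolic => ->; ring.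
split; last split.
- move=> H [->|[p [r [_ pr ->]]]]; first exact: L_inf_invariant.
  have [QN ->] := tangent_coord _ _ _ _ c_neq0 tr4 _ _ pr.
  exact: circle_through_invariant.
- move=> p pl; apply: circle_through_invariant => //.
  exact: ell_coord.
- exact: L_inf_invariant.
Qed.
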